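(* Let $G$ be a finite abelian group. Then $G$ is cyclic-quasi-injective if and only if for every prime $p$ the $p$-component of $G$ is a homocyclic group.
   Context: A group $G$ is called cyclic-quasi-injective if for every cyclic subgroup $H$ of $G$ and every group homomorphism $f \in \operatorname{Hom}(H,G)$ there exists an endomorphism $F \in \operatorname{End}(G)$ with $F|_H = f$. The $p$-component of a finite abelian group is its Sylow $p$-subgroup. A homocyclic group ($p$ prime) is a group isomorphic to a direct product of cyclic groups of the same prime-power order, i.e. of the form $(\mathbb{Z}/p^{r}\mathbb{Z})^{l}$; the trivial group is regarded as homocyclic. *)

(* Defs.v *)
From mathcomp Require Import all_boot all_fingroup all_solvable.

Set Implicit Arguments.
Unset Strict Implicit.
Unset Printing Implicit Defensive.

Local Open Scope group_scope.

(* Finite groups are subgroups G of an ambient finGroupType, so a morphism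
   takes its values in gT; Hom(H, G) and End(G) consist of those whose image
   lies in G. *)
Definition cyclic_quasi_injective (gT : finGroupType) (G : {group gT}) : Prop :=
  forall H : {group gT}, H \subset G -> cyclic H ->
  forall f : {morphism H >-> gT}, f @* H \subset G ->
  exists F : {morphism G >-> gT}, F @* G \subset G /\ {in H, F =1 f}.

(* Main.v *)
Require Import Defs.
From mathcomp Require Import all_boot all_fingroup all_solvable.

(** Both sides say that an element of [G] has as many roots as its order
    allows.  Let [n] be the exponent of [G]; if [g = y ^+ m] with [m] dividing
    [n], then [g ^+ (n %/ m) = 1], and the property at stake is the converse.

    When all Sylow subgroups are homocyclic the converse holds: in a
    homocyclic [p]-group of exponent [p ^ e] the elements killed by
    [p ^ (e - a)] are exactly the [p ^ a]-th powers, and the prime parts of [m]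
    can be treated one at a time on the [p]-constituents of [g]
    ([exists_root]).  Such a group passes a form of Baer's test: given
    [f : K -> G] and [x] in [G], let [m] be the order of [x] modulo [K].  Then
    [f (x ^+ m)] is killed by [n %/ m], so it has an [m]-th root [y], and
    sending [x] to [y] extends [f] to [K <*> <[x]>]
    ([extend_morphism_cycle]).  Iterating reaches [G], so homomorphisms extend
    from every subgroup, cyclic or not ([extend_morphism]).

    Conversely, let [P] be the Sylow [p]-subgroup, [p ^ e] its exponent, and
    [z] in [P] of order [p ^ e].  Any element [x] of [P] with [x ^+ p = 1] is
    the image of [z ^+ (p ^ e.-1)] under a homomorphism of the cyclic group
    generated by the latter; an endomorphism [F] of [G] extending it gives
    [x = F z ^+ (p ^ e.-1)].  Thus the first Omega subgroup of [P] is its last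
    nontrivial Mho subgroup, which characterises homocyclic groups. *)

Set Implicit Arguments.
Unset Strict Implicit.
Unset Printing Implicit Defensive.

Local Open Scope group_scope.

Section CyclicQuasiInjective.

Variables (gT : finGroupType) (G : {group gT}).
Implicit Types (p m : nat) (x g : gT) (K P : {group gT}).

Lemma homocyclic_root p a P x :
    p.-group P -> homocyclic P -> a <= logn p (exponent P) -> x \in P ->
    x ^+ (p ^ (logn p (exponent P) - a)) = 1 ->
  exists2 y, y \in P & x = y ^+ (p ^ a).
Proof.
move=> pP homoP le_a_e Px x1; have [cPP _] := andP homoP.
have: x \in 'Ohm_(logn p (exponent P) - a)(P).
  by rewrite (OhmE _ pP) mem_gen // !inE Px x1 eqxx.
rewrite (homocyclic_Ohm_Mho _ pP homoP) subKn // (MhoEabelian _ pP cPP).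
by case/imsetP=> y Py ->; exists y.
Qed.

Hypothesis cGG : abelian G.

(** The set of [m]-th powers is a subgroup, so it is enough to find a root of
    each [p]-constituent of [g].  That constituent has a [p ^ a]-th root in the
    Sylow [p]-subgroup, where [p ^ a] is the [p]-part of [m], and there raising
    to the [p^']-part of [m] is invertible. *)
Lemma exists_root m g :
    (forall p, prime p -> forall P, p.-Sylow(G) P -> homocyclic P) ->
    m %| exponent G -> g \in G -> g ^+ (exponent G %/ m) = 1 ->
  exists2 y, y \in G & y ^+ m = g.
Proof.
move=> homoG dv_m_n Gg g1; have n_gt0 := exponent_gt0 G.
have m_gt0 := dvdn_gt0 n_gt0 dv_m_n.
rewrite -(prod_constt g); elim/big_ind: _ => [|u v [y Gy <-] [z Gz <-]|p _].
- by exists 1; rewrite ?group1 ?expg1n.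
- by exists (y * z); rewrite ?groupM // expgMn //; apply: (centsP cGG).
have [p_pr | p'pr] := boolP (prime p); last first.
  (* For [p] not prime the [p]-constituent is trivial. *)
  exists 1; rewrite ?expg1n //; apply/esym/constt1P/pnatP => // q q_pr _.
  by apply: contraNneq p'pr => <-.
have [P sylP] := Sylow_exists p G; have pP := pHall_pgroup sylP.
have nsPG: P <| G by rewrite -sub_abelian_normal ?(pHall_sub sylP).
have Pgp: g.`_p \in P.
  by rewrite (mem_normal_Hall sylP nsPG) ?p_elt_constt ?groupX.
have eE: logn p (exponent P) = logn p (exponent G).
  by rewrite (exponent_Hall sylP) p_part pfactorK.
have homoP := homoG p p_pr P sylP.
have [||y Py ->] := homocyclic_root (a := logn p m) pP homoP _ Pgp.
- by rewrite eE dvdn_leq_log.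
- have -> : (p ^ (logn p (exponent P) - logn p m))%N = ((exponent G %/ m)`_p)%N.
    by rewrite p_part logn_div // eE.
  apply/eqP; rewrite -order_dvdn order_constt partn_dvd //; last first.
    by rewrite order_dvdn g1.
  by rewrite divn_gt0 // dvdn_leq.
have co_P_m: coprime #|P| m`_p^' by apply: (@pnat_coprime p); rewrite ?part_pnat.
have Gy := subsetP (normal_sub nsPG) y Py.
exists (y ^+ expg_invn P m`_p^'); first exact: groupX.
rewrite -{2}(partnC p m_gt0) mulnC expgM -[_ ^+ _ ^+ m`_p^']expgM mulnC expgM.
by rewrite (expgK co_P_m) // p_part.
Qed.

Hypothesis root_G : forall m g, m %| exponent G -> g \in G ->
  g ^+ (exponent G %/ m) = 1 -> exists2 y, y \in G & y ^+ m = g.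

(** Prescribing [x |-> y] is compatible with [f] exactly when
    [y ^+ m = f (x ^+ m)], where [m] is the order of [x] modulo [K]. *)
Lemma extend_morphism_cycle K (f : {morphism K >-> gT}) x :
    K \subset G -> f @* K \subset G -> x \in G ->
  exists F : {morphism K <*> <[x]> >-> gT},
    F @* (K <*> <[x]>) \subset G /\ {in K, F =1 f}.
Proof.
move=> sKG sfG Gx; set m := #[coset K x].
have nKx: x \in 'N(K) by apply: (subsetP (sub_abelian_norm cGG sKG)).
have in_K i: (x ^+ i \in K) = (m %| i).
  rewrite order_dvdn -morphX //; apply/idP/eqP; first exact: coset_id.
  by apply: coset_idr; rewrite groupX.
have Kxm: x ^+ m \in K by rewrite in_K.
have dv_m_x: m %| #[x] by rewrite -in_K expg_order.
have dv_m_n: m %| exponent G := dvdn_trans dv_m_x (dvdn_exponent Gx).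
have Gfxm: f (x ^+ m) \in G by rewrite (subsetP sfG) ?mem_morphim.
have [|y Gy ym] := root_G dv_m_n Gfxm.
  by rewrite -morphX // -expgM mulnC divnK // expg_exponent // morph1.
have dv_y_x: #[y] %| #[x].
  rewrite order_dvdn -(divnK dv_m_x) mulnC expgM ym -morphX // -expgM.
  by rewrite mulnC divnK // expg_order morph1.
have sxG: <[x]> \subset G by rewrite cycle_subG.
have defKx : K \* <[x]> = K <*> <[x]>.
  exact: cprodEY (sub_abelian_cent2 cGG sxG sKG).
have syG: eltm dv_y_x @* <[x]> \subset G by rewrite im_eltm cycle_subG.
have cfy := sub_abelian_cent2 cGG syG sfG.
have eqf: {in K :&: <[x]>, f =1 eltm dv_y_x}.
  move=> z /setIP[Kz /cycleP[i def_z]].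
  move: Kz; rewrite def_z in_K => /dvdnP[j ->].
  by rewrite eltmE mulnC !expgM ym; apply: morphX.
exists (cprodm_morphism defKx cfy eqf); split; last exact: cprodmEl.
by rewrite /= im_cprodm mul_subG.
Qed.

Lemma extend_morphism K (f : {morphism K >-> gT}) :
    K \subset G -> f @* K \subset G ->
  exists F : {morphism G >-> gT}, F @* G \subset G /\ {in K, F =1 f}.
Proof.
have [n] := ubnP (#|G| - #|K|); elim: n K f => // n IHn K f lt_n sKG sfG.
have [eqKG | [x Gx K'x]] : K = G \/ exists2 x, x \in G & x \notin K.
- have := sKG; rewrite subEproper => /predU1P[/val_inj|/properP[]]; first by left.
  by right.
- by subst K; exists f.
have [F [sFG eqFf]] := extend_morphism_cycle sKG sfG Gx.
have sKxG: K <*> <[x]> \subset G by rewrite join_subG sKG cycle_subG.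
have ltK: #|K| < #|K <*> <[x]>|.
  rewrite proper_card // properE joing_subl join_subG subxx cycle_subG.
  exact: K'x.
have [|F' [sF'G eqF'F]] := IHn _ F _ sKxG sFG.
  apply: leq_trans (ltn_sub2l _ ltK) _ => //.
  exact: leq_trans ltK (subset_leq_card sKxG).
exists F'; split=> // z Kz.
by rewrite eqF'F ?eqFf // (subsetP (joing_subl _ _)).
Qed.

End CyclicQuasiInjective.

(** Extensions from subgroups of order [p] are all that is used: they carry
    the deepest root in [P] of one element of order [p] to the others. *)
Lemma cyclic_quasi_injective_homocyclic (gT : finGroupType) (G : {group gT}) p
    (P : {group gT}) :
    abelian G -> cyclic_quasi_injective G -> p.-Sylow(G) P ->
  homocyclic P.
Proof.
move=> cGG qiG sylP; have pP := pHall_pgroup sylP; have sPG := pHall_sub sylP.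
have cPP := abelianS sPG cGG.
have nsPG: P <| G by rewrite -sub_abelian_normal.
apply/(Ohm1_homocyclicP pP cPP); set e := logn p _.
have [-> | ntP] := eqVneq P 1%G; first by rewrite Ohm1 Mho1.
have [p_pr _ _] := pgroup_pdiv pP ntP.
have [z Pz oz] := exponent_witness (abelian_nil cPP).
have nE: exponent P = (p ^ e)%N.
  by rewrite -p_part part_pnat_id // pnat_exponent.
have e_gt0: 0 < e.
  rewrite lt0n; apply: contraNneq ntP => e0.
  by rewrite -val_eqE /= trivg_exponent nE e0.
rewrite (OhmEabelian pP (abelianS (Ohm_sub _ _) cPP)) (MhoEabelian _ pP cPP).
rewrite expn1; apply/eqP; rewrite eqEsubset; apply/andP; split; last first.
  apply/subsetP=> _ /imsetP[y Py ->]; rewrite !inE groupX //= -expgM -expnSr.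
  by rewrite prednK // -nE expg_exponent.
apply/subsetP=> x; rewrite !inE => /andP[Px /eqP xp].
set w := z ^+ (p ^ e.-1).
have ow: #[w] = p.
  rewrite orderXdiv -oz nE ?dvdn_exp2l ?leq_pred //.
  by rewrite -expnB ?leq_pred ?prime_gt0 // -subn1 subKn.
have dv_x_w: #[x] %| #[w] by rewrite ow order_dvdn xp.
have Gz := subsetP sPG z Pz.
have sxG: eltm dv_x_w @* <[w]> \subset G.
  by rewrite im_eltm cycle_subG (subsetP sPG).
have swG: <[w]> \subset G by rewrite cycle_subG groupX.
have [F [sFG eqF]] := qiG _ swG (cycle_cyclic w) (eltm_morphism dv_x_w) sxG.
have pz := mem_p_elt pP Pz.
(* [F] a priori only maps into [G], but it sends [p]-elements to [p]-elements. *)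
apply/imsetP; exists (F z).
  rewrite (mem_normal_Hall sylP nsPG) ?morph_p_elt //.
  by rewrite (subsetP sFG) ?mem_morphim.
by rewrite -morphX // -/w eqF ?cycle_id //= eltm_id.
Qed.

Theorem theorem1p1 (gT : finGroupType) (G : {group gT}) (abelG : abelian G) :
  cyclic_quasi_injective G <->
  (forall p : nat, prime p ->
   forall P : {group gT}, p.-Sylow(G) P -> homocyclic P).
Proof.
split=> [qiG p _ P | homoG H sHG _ f sfG].
  exact: cyclic_quasi_injective_homocyclic.
by apply: extend_morphism => // m g; apply: exists_root.
Qed.
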